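(* Let $E,F\in\mathcal M'=\mathcal M'(J,\{n_k\},r)$ be two Moran sets with Moran structures $\{J^E_{\mathbf i}:\mathbf i\in D\}$ and $\{J^F_{\mathbf i}:\mathbf i\in D\}$. Suppose that each of the two structures $\{J_{\mathbf i}\}$ satisfies the following: there is a constant $C'>0$ such that for any $n\ge1$ and $\mathbf u,\mathbf v\in D_n$, either $J_{\mathbf u}\cap J_{\mathbf v}\ne\emptyset$ or $\operatorname{dist}(J_{\mathbf u},J_{\mathbf v})\ge C'r^n$. Then $E$ and $F$ are Lipschitz equivalent, i.e. there are a bijection $\tau:E\to F$ and a constant $C>0$ such that $C^{-1}|x-y|\le|\tau(x)-\tau(y)|\le C|x-y|$ for all $x,y\in E$.
   Context: Let $\{n_k\}_{k\ge1}$ be integers with $n_k\ge2$ and let $r\in(0,1)$ satisfy $n_kr\le1$ for all $k$. Let $D_0=\{\emptyset\}$ (the empty word), $D_k=\prod_{j=1}^k\{1,\dots,n_j\}$, $D=\bigcup_{k\ge0}D_k$; concatenation is denoted by juxtaposition. $|A|$ denotes the diameter of a set $A$, $\operatorname{dist}$ the Euclidean distance between sets, and $\#$ cardinality. Let $J\subset\mathbb R^d$ be a connected compact set with nonempty interior. The class $\mathcal M'=\mathcal M'(J,\{n_k\},r)$ consists of all Moran sets $E=\bigcap_{k\ge0}\bigcup_{\mathbf i\in D_k}J_{\mathbf i}$ where $\{J_{\mathbf i}:\mathbf i\in D\}$ is a collection of subsets of $J$ such that: (i) $J_\emptyset=J$; (ii) for each $\mathbf i\in D$ there is a similarity $S_{\mathbf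 i}:\mathbb R^d\to\mathbb R^d$ with $J_{\mathbf i}=S_{\mathbf i}(J)$; (iii) for every $k\ge1$ and $\mathbf i\in D_{k-1}$, the sets $J_{\mathbf i1},\dots,J_{\mathbf in_k}$ are subsets of $J_{\mathbf i}$ with pairwise disjoint interiors; (iv) for every $k\ge1$, $\mathbf i\in D_{k-1}$, $1\le j\le n_k$: $|J_{\mathbf ij}|/|J_{\mathbf i}|=r$; (v) there exists $L\in\mathbb N$ such that for any $k\ge1$ and any subset $T\subset D_{k-1}$, if $\bigcup_{\mathbf i\in T}J_{\mathbf i}$ is a (topological) connected component of $\bigcup_{\mathbf i\in D_{k-1}}J_{\mathbf i}$, then $\#T\le L$; (vi) for any $k\ge1$ and any $T\subset D_{k-1}$, with $b=\#T$, the union of all next-step subsets of $\bigcup_{\mathbf i\in T}J_{\mathbf i}$ can be written as $b$ disjoint groups $$\bigcup_{\mathbf i\in T}\bigcup_{j=1}^{n_k}J_{\mathbf ij}=\Big(\bigcup_{l\in\Lambda_1}C_l\Big)\cup\cdots\cup\Big(\bigcup_{l\in\Lambda_b}C_l\Big),$$ where the $C_l$ are the (topological) connected components of $\bigcup_{\mathbf i\in T}\bigcup_{j=1}^{n_k}J_{\mathbf ij}$ and every group contains exactly $n_k$ of the sets $J_{\mathbf ij}$ ($\mathbf i\in T$, $1\le j\le n_k$). *)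

(* Defs.v *)
From mathcomp Require Import all_boot all_order all_algebra.
From mathcomp Require Import all_classical all_reals all_analysis.
Set Implicit Arguments.
Unset Strict Implicit.
Unset Printing Implicit Defensive.

Import Order.TTheory GRing.Theory Num.Theory.
Import numFieldNormedType.Exports.
Local Open Scope classical_set_scope.
Local Open Scope card_scope.
Local Open Scope ring_scope.

Section Euclidean.
Variables (R : realType) (d : nat).
Implicit Types (A B : set 'rV[R]_d) (x y : 'rV[R]_d).

(* The library norm on ['rV[R]_d] is the max norm; it induces the same topology
   as [edist2], so [compact], [connected] and interiors are the library's. *)
Definition edist2 x y : R := Num.sqrt (\sum_(i < d) (x ord0 i - y ord0 i) ^+ 2).

Definition diam A : R := sup [set edist2 x y | x in A & y in A].

Definition set_dist A B : R := inf [set edist2 x y | x in A & y in B].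

Definition similarity (S : 'rV[R]_d -> 'rV[R]_d) : Prop :=
  exists2 c : R, 0 < c & forall x y, edist2 (S x) (S y) = c * edist2 x y.

Definition components A : set (set 'rV[R]_d) :=
  [set connected_component A x | x in A].

Definition lipschitz_equivalent (E F : set 'rV[R]_d) : Prop :=
  exists tau : 'rV[R]_d -> 'rV[R]_d, set_bij E F tau /\
    exists2 C : R, 0 < C & forall x y, E x -> E y ->
      C^-1 * edist2 x y <= edist2 (tau x) (tau y) <= C * edist2 x y.

End Euclidean.

Section Words.
Variable n : nat -> nat.

Definition letters (k : nat) : set nat := [set j | (1 <= j <= n k)%N].

(* Position [i] of a sequence (counted from 0) carries the letter of
   index [i.+1], so [n 0] is never used. *)
Definition words (k : nat) : set (seq nat) :=
  [set w | size w = k /\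
    forall i, (i < k)%N -> letters i.+1 (nth 0%N w i)].

Definition children (k : nat) (T : set (seq nat)) : set (seq nat) :=
  [set rcons w j | w in T & j in letters k].

End Words.

Section Moran.
Variables (R : realType) (d : nat).
Implicit Types (J : set 'rV[R]_d) (n : nat -> nat) (r : R).
Implicit Types (JJ : seq nat -> set 'rV[R]_d).

(* Only the values of [JJ] on words of [D] matter. The index [k] below ranges
   over the parent levels 0, 1, 2, ...; the children have level [k.+1]. *)
Record moran_structure J n r JJ : Prop := MoranStructure {
  moran_root : JJ [::] = J;
  moran_similar : forall k w, words n k w ->
    exists2 S : 'rV[R]_d -> 'rV[R]_d, similarity S & JJ w = S @` J;
  moran_sub : forall k w j, words n k w -> letters n k.+1 j ->
    JJ (rcons w j) `<=` JJ w;
  moran_disjoint : forall k w, words n k w ->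
    trivIset (letters n k.+1) (fun j => (JJ (rcons w j))°);
  moran_ratio : forall k w j, words n k w -> letters n k.+1 j ->
    diam (JJ (rcons w j)) / diam (JJ w) = r;
  moran_components : exists L : nat, forall k (T : set (seq nat)),
    T `<=` words n k ->
    components (\bigcup_(w in words n k) JJ w) (\bigcup_(w in T) JJ w) ->
    T #<= `I_L;
  (* [Lam m], for [m < b], is the set of components forming the [m]-th group. *)
  moran_groups : forall k (T : set (seq nat)) (b : nat),
    T `<=` words n k -> T #= `I_b ->
    exists Lam : nat -> set (set 'rV[R]_d),
      [/\ trivIset `I_b Lam,
          \bigcup_(m in `I_b) Lam m =
            components (\bigcup_(w in children n k.+1 T) JJ w) &
          forall m, (m < b)%N ->
            [set w | children n k.+1 T w /\ JJ w `<=` \bigcup_(C in Lam m) C]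
              #= `I_(n k.+1)]
}.

Definition moran_set n JJ : set 'rV[R]_d :=
  \bigcap_(k in [set: nat]) \bigcup_(w in words n k) JJ w.

Definition separated_structure n r JJ : Prop :=
  exists2 C' : R, 0 < C' & forall k u v, (1 <= k)%N ->
    words n k u -> words n k v ->
    JJ u `&` JJ v !=set0 \/ C' * r ^+ k <= set_dist (JJ u) (JJ v).

End Moran.

(* Main.v *)
Require Import Defs.
From mathcomp Require Import all_boot all_order all_algebra.
From mathcomp Require Import all_classical all_reals all_analysis.
Import Order.TTheory GRing.Theory Num.Theory.
Import numFieldNormedType.Exports.
Local Open Scope classical_set_scope.
Local Open Scope card_scope.
Local Open Scope ring_scope.

Set Implicit Arguments.
Unset Strict Implicit.
Unset Printing Implicit Defensive.

(** Both sets are bi-Lipschitz to one and the same ultrametric space: the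
    sequences of letters [codes n], two sequences that first differ at rank [k]
    being at distance about [r ^+ k]. The equivalence is the composition of one
    coding with the inverse of the other.

    To code a Moran set, fix a level and call two words linked when their pieces
    lie in the same connected component of the union of that level. Components
    have at most [L] pieces, so linked pieces of level [k] are within
    [O(r ^+ k)] of each other ([linked_dist]), while pieces of level [k] that are
    not linked are disjoint and hence at least [C' * r ^+ k] apart. The tree of
    components thus describes the metric of the set, but its shape depends on the
    structure: a component with [b] pieces may split into components of any sizes.

    The grouping condition repairs this. Apply it to the [b] words of one
    component: their children fall into [b] groups of [n k.+1] words each, and a
    group is a union of components. Matching the groups with the [b] words gives
    every word a new parent ([global_redistribution]). The new parent is linked to
    the old one, linked words have the same new parent, and every word has exactly
    [n k.+1] new children, numbered by the letters. The new tree therefore has the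
    same shape for all structures, and it still describes the metric: a point of
    the set determines at each level the new parent [a k] of any word of level
    [k.+1] whose piece contains it. Points with the same [a k] lie in the same
    component of level [k]; points with different [a k] lie in different
    components of level [k.+1]. Reading the numbers along the branch [a] is the
    coding ([moran_coding]), and compactness shows that every branch occurs
    ([branch_limit]). *)

(** * Euclidean distance and connected sets *)

Section EuclideanDistance.
Context {R : realType} {d : nat}.
Implicit Types (x y : 'rV[R]_d) (A B : set 'rV[R]_d).

Lemma edist2_ge0 x y : 0 <= edist2 x y.
Proof. exact: sqrtr_ge0. Qed.

Lemma edist2xx x : edist2 x x = 0.
Proof. by rewrite /edist2 big1 ?sqrtr0 // => i _; rewrite subrr expr0n. Qed.

Lemma mx_norm_le_edist2 x y : `|x - y| <= edist2 x y.
Proof.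
have le_coord i : `|x ord0 i - y ord0 i| <= edist2 x y.
  rewrite -sqrtr_sqr ler_wsqrtr // (bigD1 i) //= lerDl.
  by apply: sumr_ge0 => j _; exact: sqr_ge0.
rewrite [leLHS]mx_normrE bigmax_le ?edist2_ge0 // => -[i j] _ /=.
by rewrite !mxE (ord1 i).
Qed.

Lemma edist2_le_mx_norm x y : edist2 x y <= d%:R * `|x - y|.
Proof.
have le_coord i : `|x ord0 i - y ord0 i| <= `|x - y|.
  rewrite [leRHS]mx_normrE.
  by have /= := @le_bigmax _ _ _ 0 (fun ij => `|(x - y) ij.1 ij.2|) (ord0, i);
     rewrite !mxE.
rewrite -[leRHS]ger0_norm ?mulr_ge0 // -sqrtr_sqr ler_wsqrtr //.
apply: (@le_trans _ _ (\sum_(i < d) `|x - y| ^+ 2)).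
  by apply: ler_sum => i _; rewrite -real_normK ?num_real // lerXn2r ?nnegrE.
rewrite sumr_const card_ord exprMn -[leLHS]mulr_natl ler_wpM2r ?sqr_ge0 //.
by rewrite -natrX ler_nat; case: (d) => // k; rewrite leq_pmulr.
Qed.

Lemma edist2_eq0 x y : edist2 x y = 0 -> x = y.
Proof.
move=> xy0; apply/eqP; rewrite -subr_eq0 -normr_le0 -xy0.
exact: mx_norm_le_edist2.
Qed.

Lemma dist_bound_continuous {V : normedModType R} (f : 'rV[R]_d -> V) (k : R) :
  0 <= k -> (forall x y, `|f x - f y| <= k * `|x - y|) -> continuous f.
Proof.
move=> k0 fk x.
apply/(@cvgrPdist_lt _ _ _ (nbhs x) (nbhs_filter x)) => e e0.
have k1 : 0 < k + 1 by rewrite ltr_wpDl.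
near=> y; apply: (@le_lt_trans _ _ ((k + 1) * `|x - y|)).
  by apply: le_trans (fk _ _) _; rewrite ler_wpM2r // lerDl.
rewrite mulrC -ltr_pdivlMr //; near: y.
apply: (@cvgr_dist_lt _ _ _ (nbhs x) (nbhs_filter x) id x) => //.
by rewrite divr_gt0.
Unshelve. all: by end_near. Qed.

Lemma continuous_similarity (S : 'rV[R]_d -> 'rV[R]_d) :
  similarity S -> continuous S.
Proof.
move=> [c c0 Sc]; apply: (@dist_bound_continuous _ _ (c * d%:R)).
  by rewrite mulr_ge0 // ltW.
move=> x y; apply: le_trans (mx_norm_le_edist2 _ _) _.
by rewrite Sc -mulrA ler_pM2l // edist2_le_mx_norm.
Qed.

Lemma edist2_le_diam A x y : compact A -> A x -> A y -> edist2 x y <= diam A.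
Proof.
move=> /compact_bounded[M [_ AM]] Ax Ay; apply: ub_le_sup; last first.
  by exists x => //; exists y.
have {}AM z : A z -> `|z| <= M + 1 by apply: AM; rewrite ltrDl.
exists (d%:R * (M + 1 + (M + 1))) => _ [u Au] [v Av <-].
apply: le_trans (edist2_le_mx_norm _ _) _; rewrite ler_wpM2l //.
by apply: le_trans (ler_normB _ _) _; rewrite lerD ?AM.
Qed.

Lemma set_dist_le A B x y : A x -> B y -> set_dist A B <= edist2 x y.
Proof.
move=> Ax By; apply: ge_inf; last by exists x => //; exists y.
by exists 0 => _ [u _] [v _ <-]; exact: edist2_ge0.
Qed.

(** A connected set meets every sphere between two of its points, so it contains
    [L.+1] points whose distances to [x] are the multiples of [`|x - y| / L].
    Two of these lie in the same piece, hence [`|x - y| / L <= e]. The maximum norm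
    makes the triangle inequality available; it costs a factor [d] in [edist2]. *)
Lemma connected_cover_dist {I : Type} (C : set 'rV[R]_d) (T : set I)
    (A : I -> set 'rV[R]_d) (L : nat) (e : R) x y :
  connected C -> C `<=` \bigcup_(i in T) A i -> T #<= `I_L ->
  (forall i u v, T i -> A i u -> A i v -> `|u - v| <= e) ->
  C x -> C y -> `|x - y| <= L%:R * e.
Proof.
move=> Cconn CA TL Ae Cx Cy; rewrite leNgt; apply/negP => lt_xy.
pose f z := `|x - z|.
have fcont : continuous f.
  apply: (@dist_bound_continuous R^o _ 1) => // u v; rewrite mul1r.
  apply: le_trans (ler_dist_dist _ _) _.
  by rewrite opprB addrC addrA subrK distrC.
have /connected_intervalP fC : connected (f @` C).
  exact/connected_continuous_connected/continuous_subspaceT.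
(* [g i] is the [i]-th point together with a piece that contains it; for
     [L = 0] the quotient is [0] and only the point [x] is used. *)
have /choice[g gP] : forall i : nat, exists q : 'rV[R]_d * I, (i <= L)%N ->
    [/\ f q.1 = i%:R * (`|x - y| / L%:R), T q.2 & A q.2 q.1].
  move=> i; have [iL|_] := leqP i L; last first.
    by have [j Tj Aj] := CA x Cx; exists (x, j).
  have : (f @` C) (i%:R * (`|x - y| / L%:R)).
    apply: (fC 0 `|x - y|).
    - by exists x => //; rewrite /f subrr normr0.
    - by exists y.
    rewrite mulr_ge0 ?divr_ge0 //=; have [->|L0] := posnP L.
      by rewrite invr0 !mulr0.
    by rewrite mulrCA ler_piMr // ler_pdivrMr ?ltr0n // mul1r ler_nat.
  by move=> [z Cz fz]; have [j Tj Aj] := CA z Cz; exists (z, j).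
have : `I_L.+1 #<= `I_L; last by rewrite card_le_II ltnn.
pose h i := (g i).2.
suff h_inj : {in `I_L.+1 &, injective h}.
  have /card_eqPle[_ /card_le_trans] := inj_card_eq h_inj; apply.
  apply: card_le_trans TL; apply: subset_card_le => _ [i iL <-].
  by have [] := gP i iL.
move=> i j; rewrite !inE /= /h.
wlog lt_ij : i j / (i < j)%N => [H iL jL gij|iL jL gij].
  have [lt_ij|lt_ji|//] := ltngtP i j; first exact: H.
  by apply/esym/H.
have L0 : 0 < L%:R :> R.
  by rewrite ltr0n (@leq_trans j) // (leq_ltn_trans _ lt_ij).
have [fi Ti Ai] := gP i iL; have [fj Tj Aj] := gP j jL.
have : `|f (g j).1 - f (g i).1| <= e.
  apply: le_trans (ler_dist_dist _ _) _.
  by rewrite opprB addrC addrA subrK (Ae (g i).2) ?gij // -gij.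
rewrite fi fj -mulrBl leNgt => /negP[].
apply: (@lt_le_trans _ _ (`|x - y| / L%:R)).
  by rewrite ltr_pdivlMr // mulrC.
rewrite -natrB ?(ltnW lt_ij) // ger0_norm ?mulr_ge0 ?divr_ge0 ?normr_ge0 ?ler0n //.
by rewrite ler_peMl ?divr_ge0 ?ler0n // ler1n subn_gt0.
Qed.

End EuclideanDistance.

(** * The model space *)

Lemma eq0_le_geometric {R : realType} (e C r : R) :
  0 < r -> r < 1 -> 0 <= e -> (forall k, e <= C * r ^+ k) -> e = 0.
Proof.
move=> r0 r1 e0 eC; apply/eqP; rewrite eq_le e0 andbT.
have /cvgP cv : geometric C r @ \oo --> (0 : R).
  by apply: cvg_geometric; rewrite ger0_norm // ltW.
have <- : limn (geometric C r) = 0.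
  by apply: cvg_lim => //; apply: cvg_geometric; rewrite ger0_norm // ltW.
by apply: limr_ge => //; near=> k; exact: eC.
Unshelve. all: by end_near. Qed.

Definition codes (n : nat -> nat) : set (nat -> nat) :=
  [set s | forall k, letters n k.+1 (s k)].

(** [code] is a bi-Lipschitz bijection from [E] onto the infinite product of the
    alphabets, with the ultrametric [r ^+ k] for sequences whose longest common
    prefix has length [k]. The metric is encoded by its balls, so that each
    direction can be used without computing that length. *)
Definition ultrametric_coding {R : realType} {d : nat} (n : nat -> nat) (r : R)
    (E : set 'rV[R]_d) (code : 'rV[R]_d -> nat -> nat) (c C : R) : Prop :=
  [/\ 0 < c, 0 < C, set_bij E (codes n) code,
      forall x y k, E x -> E y ->
        (forall i, (i < k)%N -> code x i = code y i) -> edist2 x y <= C * r ^+ k &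
      forall x y k, E x -> E y ->
        (exists2 i, (i < k)%N & code x i <> code y i) -> c * r ^+ k <= edist2 x y].

(** * Words and pieces *)

Section MoranStructures.
Context {R : realType} {d : nat} {J : set 'rV[R]_d} {n : nat -> nat} {r : R}.
Context {JJ : seq nat -> set 'rV[R]_d}.
Hypotheses (J_connected : connected J) (J_compact : compact J).
Hypotheses (J_nonempty : J !=set0) (r_gt0 : 0 < r).
Hypothesis JJ_moran : moran_structure J n r JJ.

Implicit Types (k : nat) (u v w : seq nat) (x y z : 'rV[R]_d).

Definition parent w := take (size w).-1 w.

Lemma parent_rcons w j : parent (rcons w j) = w.
Proof. by rewrite /parent size_rcons -cats1 take_size_cat. Qed.

Lemma words0 : words n 0 [::].
Proof. by split. Qed.

Lemma words0_inv w : words n 0 w -> w = [::].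
Proof. by move=> [/size0nil]. Qed.

Lemma words_rcons k w j :
  words n k w -> letters n k.+1 j -> words n k.+1 (rcons w j).
Proof.
move=> [wk wn] jn; split=> [|i]; first by rewrite size_rcons wk.
rewrite ltnS leq_eqVlt nth_rcons wk => /orP[/eqP->|ik]; first by rewrite ltnn eqxx.
by rewrite ik; exact: wn.
Qed.

Lemma words_rcons_inv k w : words n k.+1 w ->
  exists u j, [/\ w = rcons u j, words n k u & letters n k.+1 j].
Proof.
case/lastP: w => [[]//|u j] [] /eqP; rewrite size_rcons eqSS => /eqP uk un.
exists u, j; split => //; last first.
  by have := un k (ltnSn k); rewrite nth_rcons uk ltnn eqxx.
split=> // i ik; have := un i (ltnW ik).
by rewrite nth_rcons uk ik.
Qed.

Lemma words_parent k w : words n k.+1 w -> words n k (parent w).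
Proof. by move=> /words_rcons_inv[u [j [-> uk _]]]; rewrite parent_rcons. Qed.

Lemma children_words k K : K `<=` words n k -> children n k.+1 K `<=` words n k.+1.
Proof. by move=> Kk _ [w Kw [j jn <-]]; apply: words_rcons => //; exact: Kk. Qed.

Lemma childrenP k K w : words n k.+1 w -> K (parent w) -> children n k.+1 K w.
Proof.
move=> /words_rcons_inv[u [j [-> _ jn]]]; rewrite parent_rcons => Ku.
by exists u => //; exists j.
Qed.

Lemma children_parent k K w : children n k.+1 K w -> K (parent w).
Proof. by move=> [u Ku [j _ <-]]; rewrite parent_rcons. Qed.

Lemma finite_letters k : finite_set (letters n k).
Proof.
by apply: (@sub_finite_set _ _ `I_(n k).+1) => // j /= /andP[_]; rewrite ltnS.
Qed.

Lemma finite_words k : finite_set (words n k).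
Proof.
elim: k => [|k IHk].
  by apply: (@sub_finite_set _ _ [set [::]]) => // w /words0_inv.
apply: (sub_finite_set _ (finite_image2 rcons IHk (finite_letters k.+1))).
by move=> w /words_rcons_inv[u [j [-> uk jn]]]; exists u => //; exists j.
Qed.

Lemma piece_connected k w : words n k w -> connected (JJ w).
Proof.
move=> /(moran_similar JJ_moran)[S /continuous_similarity Sc ->].
exact/connected_continuous_connected/continuous_subspaceT.
Qed.

Lemma piece_compact k w : words n k w -> compact (JJ w).
Proof.
move=> /(moran_similar JJ_moran)[S /continuous_similarity Sc ->].
exact/continuous_compact/J_compact/continuous_subspaceT.
Qed.

Lemma piece_nonempty k w : words n k w -> JJ w !=set0.
Proof.
by move=> /(moran_similar JJ_moran)[S _ ->]; have [x Jx] := J_nonempty; exists (S x), x.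
Qed.

Lemma piece_sub_parent k w : words n k.+1 w -> JJ w `<=` JJ (parent w).
Proof.
move=> /words_rcons_inv[u [j [-> uk jn]]]; rewrite parent_rcons.
exact: (moran_sub JJ_moran uk jn).
Qed.

Lemma diam_piece k w : words n k w -> diam (JJ w) = r ^+ k * diam J.
Proof.
elim: k w => [|k IHk] w; first by move=> /words0_inv->; rewrite (moran_root JJ_moran) mul1r.
move=> /words_rcons_inv[u [j [-> uk jn]]].
have ratio := moran_ratio JJ_moran uk jn.
have diam_neq0 : diam (JJ u) != 0.
  by apply: contraPN ratio => /eqP->; rewrite invr0 mulr0 => /esym/eqP; rewrite gt_eqF.
by rewrite exprS -mulrA -(IHk u uk) -ratio divfK.
Qed.

(** * Components of a level *)

Definition level k := \bigcup_(w in words n k) JJ w.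

Lemma level_decreasing k : level k.+1 `<=` level k.
Proof.
move=> x [w wk Jx]; exists (parent w); first exact: words_parent.
exact: (piece_sub_parent wk Jx).
Qed.

(** Linked words are those whose pieces lie in the same connected component of
    the level. Asking only for some connected set that contains both pieces makes
    the change from one ambient set to another immediate. *)
Definition linked k u v :=
  exists2 Z, connected Z /\ Z `<=` level k & JJ u `<=` Z /\ JJ v `<=` Z.

Lemma linked_sym k u v : linked k u v -> linked k v u.
Proof. by move=> [Z ? []]; exists Z. Qed.

Lemma linked_connected k u v (Z : set 'rV[R]_d) : words n k u -> words n k v ->
  connected Z -> Z `<=` level k -> JJ u `&` Z !=set0 -> JJ v `&` Z !=set0 ->
  linked k u v.
Proof.
move=> uk vk Zc Zk uZ [x [vx Zx]].
have uZc : connected (JJ u `|` Z) by apply: connectedU => //; exact: piece_connected uk.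
exists (JJ u `|` Z `|` JJ v); last by split=> y ?; [left; left | right].
split; last by move=> y [[?|/Zk//]|?]; [exists u | exists v].
by apply: connectedU => //; [exists x; split => //; right | exact: piece_connected vk].
Qed.

Lemma linked_meet k u v x : words n k u -> words n k v -> JJ u x -> JJ v x ->
  linked k u v.
Proof.
move=> uk vk ux vx; apply: (@linked_connected _ _ _ [set x]) => //.
- exact: connected1.
- by move=> _ ->; exists u.
- by exists x.
- by exists x.
Qed.

Lemma linked_refl k u : words n k u -> linked k u u.
Proof. by move=> uk; have [x ux] := piece_nonempty uk; exact: (linked_meet uk uk ux ux). Qed.

Lemma linked_trans k v u w : words n k u -> words n k v -> words n k w ->
  linked k u v -> linked k v w -> linked k u w.
Proof.
move=> uk vk wk [Z [Zc Zk] [uZ vZ]] [Y [Yc Yk] [vY wY]].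
have [x vx] := piece_nonempty vk.
exists (Z `|` Y); last by split=> y ?; [left; exact: uZ | right; exact: wY].
split; last by move=> y [/Zk|/Yk].
by apply: connectedU => //; exists x; split; [exact: vZ | exact: vY].
Qed.

Lemma linked_parent k u v : words n k.+1 u -> words n k.+1 v ->
  linked k.+1 u v -> linked k (parent u) (parent v).
Proof.
move=> uk vk [Z [Zc Zk] [uZ vZ]].
have [[x ux] [y vy]] := (piece_nonempty uk, piece_nonempty vk).
apply: (@linked_connected _ _ _ Z) => //; try exact: words_parent.
- by move=> z /Zk/level_decreasing.
- by exists x; split; [exact: (piece_sub_parent uk ux) | exact: uZ].
- by exists y; split; [exact: (piece_sub_parent vk vy) | exact: vZ].
Qed.

Definition linked_class k u := [set v | words n k v /\ linked k u v].

Lemma linked_class_eq k u v : words n k u -> words n k v -> linked k u v ->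
  linked_class k u = linked_class k v.
Proof.
move=> uk vk uv; apply/seteqP; split=> w [wk lw]; split=> //.
  by apply: (@linked_trans k u) => //; exact: linked_sym.
exact: (@linked_trans k v).
Qed.

Lemma linked_component k u v x : words n k u -> words n k v -> JJ u x ->
  linked k u v -> JJ v `<=` connected_component (level k) x.
Proof.
move=> uk vk ux [Z [Zc Zk] [uZ vZ]] y vy.
by apply: (connected_component_max _ Zk Zc); [exact: uZ | exact: vZ].
Qed.

(** The component of a point of level [k] is the union of the pieces that it
    contains. There are at most [L] of these, each of diameter
    [r ^+ k * diam J], and connectedness makes these diameters add up at worst. *)
Lemma linked_dist : exists2 C : R, 0 <= C & forall k u v x y,
  words n k u -> words n k v -> linked k u v -> JJ u x -> JJ v y ->
  edist2 x y <= C * r ^+ k.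
Proof.
have [L JJ_L] := moran_components JJ_moran.
have [z Jz] := J_nonempty.
have diamJ : 0 <= diam J by rewrite -(edist2xx z); exact: edist2_le_diam.
exists (d%:R * (L%:R * diam J)) => [|k u v x y uk vk uv ux vy].
  by rewrite !mulr_ge0.
apply: le_trans (edist2_le_mx_norm _ _) _; rewrite -mulrA ler_wpM2l // -mulrA.
pose C := connected_component (level k) x.
pose T := [set w | words n k w /\ JJ w `<=` C].
have CT : C = \bigcup_(w in T) JJ w.
  apply/seteqP; split=> [t Ct|t [w [_ wC] /wC//]].
  have [w wk wt] := connected_component_sub Ct.
  exists w => //; split=> // s ws.
  have Cc : connected C := @component_connected _ _ _.
  have /connectedU : C `&` JJ w !=set0 by exists t.
  move=> /(_ Cc (piece_connected wk)) CJc.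
  apply: (connected_component_max _ _ CJc); last by right.
    by left; apply: connected_component_refl; exists u.
  by move=> q [/connected_component_sub//|]; exists w.
apply: (@connected_cover_dist _ _ _ C T JJ).
- exact: component_connected.
- by rewrite CT.
- apply: (JJ_L k); first by move=> w [].
  by rewrite -CT; exists x => //; exists u.
- move=> w s t [wk _] ws wt; apply: le_trans (mx_norm_le_edist2 _ _) _.
  rewrite mulrC -(diam_piece wk); apply: edist2_le_diam => //.
  exact: piece_compact wk.
- by apply: connected_component_refl; exists u.
- exact: (linked_component uk vk ux uv vy).
Qed.

(** * New parents *)

(** [p] gives the children of the class [K] new parents in [K], and [nu] numbers
    the children of each new parent by the letters: the pair [(p, nu)] is a
    bijection onto [K] times the alphabet. Constancy of [p] on linked words says
    that the new siblings form a union of components. *)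
Definition redistribution k (K : set (seq nat)) (p : seq nat -> seq nat)
    (nu : seq nat -> nat) : Prop :=
  [/\ forall w, children n k.+1 K w -> K (p w) /\ letters n k.+1 (nu w),
      forall w w', children n k.+1 K w -> words n k.+1 w' -> linked k.+1 w w' ->
        p w = p w',
      forall w w', children n k.+1 K w -> children n k.+1 K w' ->
        p w = p w' -> nu w = nu w' -> w = w' &
      forall u j, K u -> letters n k.+1 j ->
        exists w, [/\ children n k.+1 K w, p w = u & nu w = j]].

Lemma children_class_saturated k u w w' : words n k u ->
  children n k.+1 (linked_class k u) w -> words n k.+1 w' -> linked k.+1 w w' ->
  children n k.+1 (linked_class k u) w'.
Proof.
move=> uk Kw w'k ww'; apply: childrenP => //.
have [pk up] := children_parent Kw.
have wk : words n k.+1 w by apply: children_words Kw => v [].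
split; first exact: words_parent.
by apply: (linked_trans uk pk) => //; [exact: words_parent | exact: linked_parent].
Qed.

(** A component of level [k.+1] is connected inside level [k], hence lies over a
    single component of level [k]. So the components of the children of one class,
    to which the grouping condition refers, are components of the whole level. *)
Lemma linked_in_children k u w w' : words n k u ->
  children n k.+1 (linked_class k u) w -> words n k.+1 w' -> linked k.+1 w w' ->
  exists2 Z, connected Z /\
    Z `<=` \bigcup_(v in children n k.+1 (linked_class k u)) JJ v &
    JJ w `<=` Z /\ JJ w' `<=` Z.
Proof.
move=> uk Kw w'k [Z [Zc Zk] [wZ w'Z]].
have wk : words n k.+1 w by apply: children_words Kw => v [].
exists Z; split=> // z Zz; have [v vk vz] := Zk z Zz.
exists v => //; apply: (children_class_saturated uk Kw) => //.
have [x wx] := piece_nonempty wk.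
apply: (@linked_connected _ _ _ Z) => //; last by exists z.
by exists x; split=> //; exact: wZ.
Qed.

(** The class has as many words as its children have groups, so a bijection
    between words and groups defines [p]; each group has [n k.+1] words, and a
    bijection with the letters defines [nu]. *)
Lemma class_redistribution k u : words n k u ->
  exists p nu, redistribution k (linked_class k u) p nu.
Proof.
move=> uk; set K := linked_class k u.
have Kk : K `<=` words n k by move=> v [].
have [b Kb] : exists b, K #= `I_b.
  by apply/finite_setP/(sub_finite_set Kk)/finite_words.
have [Lam [Lam_triv Lam_cover Lam_card]] := moran_groups JJ_moran Kk Kb.
set X := \bigcup_(w in children n k.+1 K) JJ w in Lam_cover.
pose G m := [set w | children n k.+1 K w /\ JJ w `<=` \bigcup_(C in Lam m) C].
have LamP m C x : (m < b)%N -> Lam m C -> C x -> C = connected_component X x.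
  move=> mb LC Cx; have : components X C by rewrite -Lam_cover; exists m.
  by move=> [y _ yC]; move: Cx; rewrite -yC => /same_connected_component.
have G_unique m m' w : (m < b)%N -> (m' < b)%N -> G m w -> G m' w -> m = m'.
  move=> mb m'b [Kw wm] [_ wm'].
  have [x wx] := piece_nonempty (children_words Kk Kw).
  have [C LC Cx] := wm x wx; have [C' LC' Cx'] := wm' x wx.
  apply: Lam_triv => //; exists C; split=> //.
  by rewrite (LamP _ _ _ mb LC Cx) -(LamP _ _ _ m'b LC' Cx').
have G_linked m w w' : (m < b)%N -> G m w -> words n k.+1 w' -> linked k.+1 w w' ->
    G m w'.
  move=> mb [Kw wm] w'k ww'.
  split; first exact: (children_class_saturated uk Kw).
  have [Z [Zc ZX] [wZ w'Z]] := linked_in_children uk Kw w'k ww'.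
  have [x wx] := piece_nonempty (children_words Kk Kw).
  have [C LC Cx] := wm x wx; exists C => //.
  rewrite (LamP _ _ _ mb LC Cx).
  by apply: (connected_component_max _ ZX Zc); [exact: wZ | exact: w'Z].
have /choice[g gP] : forall w, exists m, children n k.+1 K w -> (m < b)%N /\ G m w.
  move=> w; have [Kw|] := pselect (children n k.+1 K w); last by exists 0%N.
  have wk := children_words Kk Kw; have [x wx] := piece_nonempty wk.
  have wX : JJ w `<=` X by move=> y wy; exists w.
  have : components X (connected_component X x) by exists x => //; exact: wX.
  rewrite -Lam_cover => -[m mb LC]; exists m => _; split=> //; split=> // y wy.
  exists (connected_component X x) => //.
  by apply: (connected_component_max wx wX (piece_connected wk)).
have [phi [phiK phi_inj phi_surj]] : exists phi, set_bij `I_b K phi.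
  have /card_set_bijP[f [fK f_inj f_surj]] := Kb.
  have /choice[phi phiP] : forall m, exists v, (m < b)%N -> K v /\ f v = m.
    move=> m; case: (ltnP m b) => [mb|]; last by exists [::].
    by have [v Kv fv] := f_surj m mb; exists v.
  exists phi; split=> [m mb|m m'|v Kv].
  - by have [] := phiP m mb.
  - rewrite !inE => mb m'b phi_eq.
    have [[_ <-] [_ <-]] := (phiP m mb, phiP m' m'b).
    by rewrite phi_eq.
  - exists (f v); first exact: fK.
    by have [? ?] := phiP (f v) (fK v Kv); apply: f_inj; rewrite ?inE.
have /choice[psi psiP] : forall m, exists f, (m < b)%N -> set_bij (G m) `I_(n k.+1) f.
  move=> m; case: (ltnP m b) => [mb|]; last by exists (fun=> 0%N).
  by have /card_set_bijP[f fbij] := Lam_card m mb; exists f.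
(* [psi] counts from [0], letters from [1]. *)
exists (phi \o g), (fun w => (psi (g w) w).+1).
split=> [w Kw|w w' Kw w'k ww'|w w' Kw Kw' /=|v j Kv].
- have [gb Gw] := gP w Kw; have [psi_fun _ _] := psiP _ gb.
  by split; [exact: phiK | exact: psi_fun].
- have Kw' := children_class_saturated uk Kw w'k ww'.
  have [gb Gw] := gP w Kw; have [gb' Gw'] := gP w' Kw'.
  congr phi; apply: (G_unique _ _ _ gb gb' _ Gw').
  exact: (G_linked _ _ _ gb Gw w'k ww').
- have [gb Gw] := gP w Kw; have [gb' Gw'] := gP w' Kw'.
  move=> /phi_inj; rewrite !inE => /(_ gb gb') gg' [].
  have [_ psi_inj _] := psiP _ gb'.
  by move: Gw; rewrite gg' => Gw /psi_inj; rewrite !inE; apply.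
- case: j => [|j] jn; first by [].
  have [m mb <-] := phi_surj v Kv; have [_ _ psi_surj] := psiP m mb.
  have [w Gw <-] := psi_surj j jn; have Kw := Gw.1.
  have [gb Gw'] := gP w Kw; have gm := G_unique _ _ _ gb mb Gw' Gw.
  by exists w; rewrite /= gm.
Qed.

(** Linked words have parents in the same class. The choice of a redistribution
    must therefore depend on the class as a set, and not on the word that
    represents it; then the redistributions of all classes glue together. *)
Lemma global_redistribution : exists p nu,
  [/\ forall k w, words n k.+1 w ->
        [/\ words n k (p w), linked k (p w) (parent w) & letters n k.+1 (nu w)],
      forall k w w', words n k.+1 w -> words n k.+1 w' -> linked k.+1 w w' ->
        p w = p w',
      forall k w w', words n k.+1 w -> words n k.+1 w' ->
        p w = p w' -> nu w = nu w' -> w = w' &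
      forall k u j, words n k u -> letters n k.+1 j ->
        exists w, [/\ words n k.+1 w, p w = u & nu w = j]].
Proof.
have /choice[f fP] : forall q : nat * set (seq nat),
    exists f : (seq nat -> seq nat) * (seq nat -> nat),
    (exists2 u, words n q.1 u & q.2 = linked_class q.1 u) ->
    redistribution q.1 q.2 f.1 f.2.
  move=> [k K]; have [[u uk /= ->]|] :=
    pselect (exists2 u, words n k u & K = linked_class k u); last first.
    by exists (id, fun=> 0%N).
  by have [p [nu pnu]] := class_redistribution uk; exists (p, nu).
have {}fP k u : words n k u -> redistribution k (linked_class k u)
    (f (k, linked_class k u)).1 (f (k, linked_class k u)).2.
  by move=> uk; apply: (fP (k, linked_class k u)); exists u.
(* [q w] is the level and the class of the parent of [w]. *)
pose q w := ((size w).-1, linked_class (size w).-1 (parent w)).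
have qP k w : words n k.+1 w ->
    q w = (k, linked_class k (parent w)) /\
    redistribution k (linked_class k (parent w)) (f (q w)).1 (f (q w)).2.
  move=> wk; have qE : q w = (k, linked_class k (parent w)) by rewrite /q wk.1.
  split=> //; rewrite qE; apply: fP; exact: words_parent.
have own k w : words n k.+1 w -> children n k.+1 (linked_class k (parent w)) w.
  move=> wk; apply: childrenP => //.
  by split; [|apply: linked_refl]; exact: words_parent.
have q_eq k w w' : words n k.+1 w -> words n k.+1 w' ->
    linked k (parent w) (parent w') -> q w = q w'.
  move=> wk w'k ww'; have [-> _] := qP _ _ wk; have [-> _] := qP _ _ w'k.
  by congr pair; apply: (linked_class_eq _ _ ww'); exact: words_parent.
exists (fun w => (f (q w)).1 w), (fun w => (f (q w)).2 w); split.
- move=> k w wk; have [_ [pK _ _ _]] := qP _ _ wk.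
  by have [[? /linked_sym ?] ?] := pK w (own _ _ wk).
- move=> k w w' wk w'k ww'; have [_ [_ p_linked _ _]] := qP _ _ wk.
  rewrite -(q_eq _ _ _ wk w'k); last exact: linked_parent.
  exact: (p_linked _ _ (own _ _ wk) w'k ww').
- move=> k w w' wk w'k pp'.
  have [_ [pK _ inj _]] := qP _ _ wk; have [_ [pK' _ _ _]] := qP _ _ w'k.
  have [[pwk lw] _] := pK w (own _ _ wk); have [[pw'k lw'] _] := pK' w' (own _ _ w'k).
  have ww' : linked k (parent w) (parent w').
    apply: (linked_trans _ _ _ lw) => //; try exact: words_parent.
    by rewrite pp'; exact: linked_sym.
  move: pp'; rewrite -(q_eq _ _ _ wk w'k ww'); apply: inj; first exact: own.
  by rewrite (linked_class_eq _ _ ww'); [exact: own | exact: words_parent..].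
- move=> k u j uk jn.
  have [_ _ _ surj] := fP k u uk.
  have [w [Kw pw nuw]] := surj u j (conj uk (linked_refl uk)) jn.
  have wk : words n k.+1 w by apply: children_words Kw => v [].
  have [pk up] := children_parent Kw.
  exists w; have [-> _] := qP _ _ wk.
  by rewrite -(linked_class_eq uk pk up).
Qed.

(** * Coding a Moran set *)

(** The components [B k] that contain the pieces of the branch are compact, and
    they decrease because the parent of each word of the branch is linked to the
    preceding word; so they have a common point. *)
Lemma branch_limit (a : nat -> seq nat) : (forall k, words n k (a k)) ->
  (forall k, linked k (a k) (parent (a k.+1))) ->
  exists x, forall k, exists w, [/\ words n k w, linked k (a k) w & JJ w x].
Proof.
move=> ak a_linked.
pose B k := \bigcup_(w in linked_class k (a k)) JJ w.
have B_closed k : closed (B k).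
  apply: closed_bigcup => [|w [wk _]].
    by apply: sub_finite_set (finite_words k) => w [].
  exact: compact_closed (@norm_hausdorff _ _) (piece_compact wk).
have B_decr k : B k.+1 `<=` B k.
  move=> x [w [wk lw] wx]; exists (parent w); last exact: (piece_sub_parent wk wx).
  split; first exact: words_parent.
  apply: (linked_trans _ _ _ (a_linked k)) => //; try exact: words_parent.
  exact: linked_parent.
have B_sub k m : (k <= m)%N -> B m `<=` B k.
  by move/subnK<-; elim: (m - k)%N => // j IHj x /B_decr/IHj.
have B0 : B 0%N `<=` J.
  by move=> x [w [/words0_inv-> _]]; rewrite (moran_root JJ_moran).
have /choice[x_ xP] : forall k, exists x, JJ (a k) x.
  by move=> k; exact: piece_nonempty (ak k).
have xB k : B k (x_ k) by exists (a k) => //; split=> //; exact: linked_refl.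
have xBF k : (x_ @ \oo) (B k).
  by exists k => // m /= km; exact: (B_sub _ _ km _ (xB m)).
have [|x [_ x_cluster]] := J_compact (F := x_ @ \oo).
  by apply: filterS (xBF 0%N).
exists x => k; have : B k x.
  by apply: B_closed => U xU; exact: x_cluster (xBF k) xU.
by move=> [w [wk lw] wx]; exists w.
Qed.

(** The branch of a point [x] is [a x k], the new parent of any word of level
    [k.+1] whose piece contains [x]. The shift by one level is what turns
    disjointness of components of level [k.+1] into the lower bound, at the cost
    of a factor [r] in the constant. *)
Lemma moran_coding : r < 1 -> separated_structure n r JJ ->
  exists code c C, ultrametric_coding n r (moran_set n JJ) code c C.
Proof.
move=> r_lt1 [c c0 JJ_sep].
have [p [nu [pP p_linked p_inj p_surj]]] := global_redistribution.
have [C C_ge0 C_dist] := linked_dist.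
set E := moran_set n JJ.
have /choice[W WP] : forall q : 'rV[R]_d * nat, exists w, E q.1 ->
    words n q.2 w /\ JJ w q.1.
  move=> [x k]; have [Ex|] := pselect (E x); last by exists [::].
  by have [w] := Ex k I; exists w.
pose a x k := p (W (x, k.+1)).
have a_words x k : E x -> words n k (a x k).
  by move=> /(WP (x, k.+1))[/pP[]].
have a_linked x k w : E x -> words n k w -> JJ w x -> linked k (a x k) w.
  move=> Ex wk wx; have [Wk Wx] := WP (x, k.+1) Ex.
  have [pk plinked _] := pP _ _ Wk.
  apply: (linked_trans pk (words_parent Wk) wk plinked).
  apply: (linked_meet (words_parent Wk) wk _ wx).
  exact: (piece_sub_parent Wk Wx).
have p_a x k w : E x -> words n k.+1 w -> JJ w x -> p w = a x k.
  move=> Ex wk wx; have [Wk Wx] := WP (x, k.+1) Ex.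
  by apply: (p_linked k) => //; exact: (linked_meet wk Wk wx Wx).
have a_step x k : E x -> p (a x k.+1) = a x k.
  move=> Ex; have [Wk Wx] := WP (x, k.+1) Ex.
  by apply: (p_linked k) => //; [exact: a_words | exact: a_linked].
(* A branch starts at the empty word, and a word is determined by its new
     parent and its number: prefixes of the code and vertices of the branch
     carry the same information. *)
pose code x k := nu (a x k.+1).
have agree_a x y k : E x -> E y -> (forall i, (i < k)%N -> code x i = code y i) ->
    a x k = a y k.
  move=> Ex Ey; elim: k => [|k IHk] xy.
    by rewrite (words0_inv (a_words x 0%N Ex)) (words0_inv (a_words y 0%N Ey)).
  apply: (p_inj k); [exact: a_words | exact: a_words | | exact: xy].
  by rewrite !a_step // IHk // => i ik; apply: xy; exact: ltnW.
have a_agree x y k i : E x -> E y -> a x k = a y k -> (i < k)%N -> code x i = code y i.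
  move=> Ex Ey axy ik; rewrite /code; congr nu.
  elim: k ik axy => // k IHk; rewrite ltnS leq_eqVlt => /orP[/eqP->//|ik] axy.
  by apply: IHk => //; rewrite -(a_step x) // -(a_step y) // axy.
have upper x y k : E x -> E y -> (forall i, (i < k)%N -> code x i = code y i) ->
    edist2 x y <= (C + 1) * r ^+ k.
  move=> Ex Ey /(agree_a _ _ _ Ex Ey) axy.
  have [Wxk Wx] := WP (x, k) Ex; have [Wyk Wy] := WP (y, k) Ey.
  apply: (@le_trans _ _ (C * r ^+ k)).
    apply: (C_dist k (W (x, k)) (W (y, k))) => //.
    apply: (linked_trans Wxk (a_words x k Ex) Wyk).
      exact/linked_sym/a_linked.
    by rewrite axy; exact: a_linked.
  by rewrite ler_wpM2r ?exprn_ge0 ?lerDl // ltW.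
have lower x y k : E x -> E y -> (exists2 i, (i < k)%N & code x i <> code y i) ->
    c * r * r ^+ k <= edist2 x y.
  move=> Ex Ey [i ik]; apply: contra_notP => /negP; rewrite -ltNge => lt_xy.
  apply: (a_agree _ _ _ _ Ex Ey _ ik).
  have [Wxk Wx] := WP (x, k.+1) Ex; have [Wyk Wy] := WP (y, k.+1) Ey.
  have [//|[z [xz yz]]|] := JJ_sep k.+1 _ _ _ Wxk Wyk.
    by apply: (p_linked k) => //; exact: (linked_meet Wxk Wyk xz yz).
  rewrite exprS mulrA => /(le_trans)/(_ (set_dist_le Wx Wy)).
  by rewrite leNgt lt_xy.
exists code, (c * r), (C + 1); split=> //; [exact: mulr_gt0|exact: ltr_wpDl|].
split.
- by move=> x Ex k; have [] := pP _ _ (a_words x k.+1 Ex).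
- move=> x y; rewrite !inE => Ex Ey xy; apply: edist2_eq0.
  apply: (@eq0_le_geometric _ _ (C + 1) r) => //; first exact: edist2_ge0.
  by move=> k; apply: upper => // i _; rewrite xy.
- move=> s sn.
  (* Each code prescribes a branch: descend from the root to the new child with
     the prescribed number. *)
  have /choice[f fP] : forall q : nat * seq nat, exists w, words n q.1 q.2 ->
      [/\ words n q.1.+1 w, p w = q.2 & nu w = s q.1].
    move=> [k u]; have [uk|] := pselect (words n k u); last by exists [::].
    by have [w] := p_surj k u _ uk (sn k); exists w.
  pose b := fix b k := if k is k'.+1 then f (k', b k') else [::].
  have b_words k : words n k (b k).
    by elim: k => [|k IHk]; [exact: words0 | have [] := fP (k, b k) IHk].
  have b_step k : p (b k.+1) = b k by have [] := fP (k, b k) (b_words k).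
  have b_code k : nu (b k.+1) = s k by have [] := fP (k, b k) (b_words k).
  have [|x xP] := branch_limit b_words.
    by move=> k; have [_ + _] := pP _ _ (b_words k.+1); rewrite b_step.
  have Ex : E x by move=> k _; have [w [wk _ wx]] := xP k; exists w.
  have a_b k : a x k = b k.
    have [w [wk bw wx]] := xP k.+1.
    by rewrite -(p_a _ _ _ Ex wk wx) -b_step; apply/esym/(p_linked k).
  by exists x => //; apply/funext => k; rewrite /code a_b.
Qed.

End MoranStructures.

(** * Comparing two codings *)

(** If the codes of [x] and [y] first differ at rank [k], the codings bound
    [edist2 x' y'] by [CF * r ^+ k] and [edist2 x y] from below by
    [cE * r ^+ k.+1]. *)
Lemma ultrametric_coding_dist {R : realType} {d : nat} (n : nat -> nat) (r : R)
    (E F : set 'rV[R]_d) codeE cE CE codeF cF CF x y x' y' :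
  0 < r ->
  ultrametric_coding n r E codeE cE CE -> ultrametric_coding n r F codeF cF CF ->
  E x -> E y -> F x' -> F y' -> codeF x' = codeE x -> codeF y' = codeE y ->
  edist2 x' y' <= CF / (cE * r) * edist2 x y.
Proof.
move=> r0 [cE0 _ [_ injE _] _ lowE] [_ CF0 [_ injF _] upF _] Ex Ey Fx Fy xx' yy'.
have [[k kP]|same] := pselect (exists k, codeE x k != codeE y k); last first.
  have xy : codeE x = codeE y.
    by apply/funext => k; apply/eqP; apply: contra_notT same => ?; exists k.
  have -> : x' = y' by apply: injF; rewrite ?inE // xx' yy' xy.
  by rewrite edist2xx mulr_ge0 ?edist2_ge0 // ltW // divr_gt0 // mulr_gt0.
have [{kP}k kP k_min] := ex_minnP (ex_intro (fun k => codeE x k != codeE y k) k kP).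
apply: (@le_trans _ _ (CF * r ^+ k)).
  apply: upF => // i ik; rewrite xx' yy'; apply/eqP.
  by apply: contraTT ik; rewrite -leqNgt => /k_min.
rewrite mulrAC ler_pdivlMr ?mulr_gt0 // -mulrA ler_pM2l //.
rewrite mulrC -mulrA -exprS; apply: lowE => //.
by exists k => //; exact/eqP.
Qed.

Theorem theorem1p3 (R : realType) (d : nat) (J : set 'rV[R]_d)
  (n : nat -> nat) (r : R)
  (J_connected : connected J) (J_compact : compact J) (J_int : J° !=set0)
  (n_ge2 : forall k, (1 <= k)%N -> (2 <= n k)%N)
  (r_gt0 : 0 < r) (r_lt1 : r < 1)
  (nr_le1 : forall k, (1 <= k)%N -> (n k)%:R * r <= 1)
  (E F : set 'rV[R]_d) (JE JF : seq nat -> set 'rV[R]_d)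
  (JE_moran : moran_structure J n r JE) (E_def : E = moran_set n JE)
  (JF_moran : moran_structure J n r JF) (F_def : F = moran_set n JF)
  (JE_sep : separated_structure n r JE) (JF_sep : separated_structure n r JF) :
  lipschitz_equivalent E F.
Proof.
have J_nonempty : J !=set0 by have [x /interior_subset Jx] := J_int; exists x.
have [codeE [cE [CE codingE]]] :=
  moran_coding J_connected J_compact J_nonempty r_gt0 JE_moran r_lt1 JE_sep.
have [codeF [cF [CF codingF]]] :=
  moran_coding J_connected J_compact J_nonempty r_gt0 JF_moran r_lt1 JF_sep.
rewrite -E_def in codingE; rewrite -F_def in codingF.
have [cE0 CE0 [funE injE surjE] _ _] := codingE.
have [cF0 CF0 [funF injF surjF] _ _] := codingF.
have /choice[tau tauP] : forall x, exists y, E x -> F y /\ codeF y = codeE x.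
  move=> x; have [Ex|] := pselect (E x); last by exists x.
  by have [y Fy] := surjF _ (funE x Ex); exists y.
exists tau; split.
  split.
  - by move=> x /tauP[].
  - move=> x y; rewrite !inE => Ex Ey tauxy; apply: injE; rewrite ?inE //.
    by have [[_ <-] [_ <-]] := (tauP x Ex, tauP y Ey); rewrite tauxy.
  - move=> y Fy; have [x Ex xy] := surjE _ (funF y Fy); exists x => //.
    by have [Fx xx] := tauP x Ex; apply: injF; rewrite ?inE // xx.
pose A := CF / (cE * r); pose B := CE / (cF * r).
have A0 : 0 < A by rewrite divr_gt0 // mulr_gt0.
have B0 : 0 < B by rewrite divr_gt0 // mulr_gt0.
exists (A + B); first exact: addr_gt0.
move=> x y Ex Ey; have [[Fx xx] [Fy yy]] := (tauP x Ex, tauP y Ey).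
apply/andP; split.
  rewrite mulrC ler_pdivrMr ?addr_gt0 // mulrC.
  apply: le_trans (ultrametric_coding_dist r_gt0 codingF codingE Fx Fy Ex Ey _ _) _ => //.
  by rewrite ler_wpM2r ?edist2_ge0 // lerDr ltW.
apply: le_trans (ultrametric_coding_dist r_gt0 codingE codingF Ex Ey Fx Fy xx yy) _.
by rewrite ler_wpM2r ?edist2_ge0 // lerDl ltW.
Qed.
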